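(* Let $R>0$, let $B=B(0,R)=\{q\in\mathbb{H}:|q|<R\}$, and let $\mathcal{B}=\{f:B\to\mathbb{H}\mid f \text{ is slice regular}\}$, regarded as a real vector space. Then the function $\|\cdot\|:\mathcal{B}\to[0,+\infty)$ defined by $\|f\|=\sup_{I\in\mathbb{S}}\|f\|_I$ is a norm on $\mathcal{B}$.
   Context: $\mathbb{H}$ is the skew field of quaternions; $\mathbb{S}=\{q\in\mathbb{H}:q^2=-1\}$; for $I\in\mathbb{S}$, $L_I=\mathbb{R}+\mathbb{R}I$ (isomorphic to $\mathbb{C}$) and $B_I=B\cap L_I$. A function $f:B\to\mathbb{H}$ is slice regular if for every $I\in\mathbb{S}$ its restriction $f_I$ to $B_I$ has continuous partial derivatives and satisfies $\frac12\left(\frac{\partial}{\partial x}+I\frac{\partial}{\partial y}\right)f_I(x+yI)=0$ for all $x+yI\in B_I$. For a slice regular function $f$ on $B$, and for $I,J\in\mathbb{S}$ with $J$ orthogonal to $I$, there exist holomorphic functions $F,G:B_I\to L_I$ such that $f_I(z)=F(z)+G(z)J$ for all $z\in B_I$. Write $\|F\|_{B_I}=\sup_{z\in B_I}|F(z)|$ and $\|G\|_{B_I}=\sup_{z\in B_I}|G(z)|$. For each $I\in\mathbb{S}$ the function $\|\cdot\|_I:\mathcal{B}\to[0,+\infty)$ is defined by $\|f\|_I^2=\|F\|_{B_I}^2+\|G\|_{B_I}^2$; it does not depend on the choice of $J$.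
   Formalization: The norm takes values in [0,+∞] instead of [0,+∞), since unbounded slice regular functions such as (1−q/R)^{-1} have ‖f‖=+∞; all norm axioms are proved on the whole space, and ‖f‖ is finite exactly when f is bounded on B. *)

(* Defs.v *)
From HB Require Import structures.
From mathcomp Require Import all_boot all_order all_algebra.
From mathcomp Require Import ring lra.
From mathcomp Require Import all_classical all_reals all_analysis.

Set Implicit Arguments.
Unset Strict Implicit.
Unset Printing Implicit Defensive.

Import Order.TTheory GRing.Theory Num.Theory.
Import numFieldNormedType.Exports.

Local Open Scope classical_set_scope.
Local Open Scope ring_scope.

Record quat (R : realType) := Quat { qre : R; qi : R; qj : R; qk : R }.

Section quaternion_algebra.
Variable R : realType.
Implicit Types (a : R) (p q : quat R).

Definition quat_tuple q : R * R * R * R := (qre q, qi q, qj q, qk q).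
Definition tuple_quat (t : R * R * R * R) : quat R :=
  Quat t.1.1.1 t.1.1.2 t.1.2 t.2.

Lemma quat_tupleK : cancel quat_tuple tuple_quat.
Proof. by case. Qed.

HB.instance Definition _ := Choice.copy (quat R) (can_type quat_tupleK).

Lemma quatP p q :
  qre p = qre q -> qi p = qi q -> qj p = qj q -> qk p = qk q -> p = q.
Proof. by case: p q => ? ? ? ? [? ? ? ?] /= -> -> -> ->. Qed.

Definition quat0 : quat R := Quat 0 0 0 0.
Definition quat1 : quat R := Quat 1 0 0 0.
Definition oppq q := Quat (- qre q) (- qi q) (- qj q) (- qk q).
Definition addq p q :=
  Quat (qre p + qre q) (qi p + qi q) (qj p + qj q) (qk p + qk q).
Definition scaleq a q := Quat (a * qre q) (a * qi q) (a * qj q) (a * qk q).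
Definition mulq p q := Quat
  (qre p * qre q - qi p * qi q - qj p * qj q - qk p * qk q)
  (qre p * qi q + qi p * qre q + qj p * qk q - qk p * qj q)
  (qre p * qj q - qi p * qk q + qj p * qre q + qk p * qi q)
  (qre p * qk q + qi p * qj q - qj p * qi q + qk p * qre q).

(** The Euclidean inner product of H = R^4. *)
Definition qdot p q : R :=
  qre p * qre q + qi p * qi q + qj p * qj q + qk p * qk q.
Definition qnorm q : R := Num.sqrt (qdot q q).
Definition conjq q := Quat (qre q) (- qi q) (- qj q) (- qk q).
Definition invq q := scaleq (qdot q q)^-1 (conjq q).

Lemma addqA : associative addq.
Proof. by move=> p q s; apply: quatP => /=; ring. Qed.
Lemma addqC : commutative addq.
Proof. by move=> p q; apply: quatP => /=; ring. Qed.
Lemma add0q : left_id quat0 addq.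
Proof. by move=> p; apply: quatP => /=; ring. Qed.
Lemma addNq : left_inverse quat0 oppq addq.
Proof. by move=> p; apply: quatP => /=; ring. Qed.

HB.instance Definition _ :=
  GRing.isZmodule.Build (quat R) addqA addqC add0q addNq.

Lemma mulqA : associative mulq.
Proof. by move=> p q s; apply: quatP => /=; ring. Qed.
Lemma mul1q : left_id quat1 mulq.
Proof. by move=> p; apply: quatP => /=; ring. Qed.
Lemma mulq1 : right_id quat1 mulq.
Proof. by move=> p; apply: quatP => /=; ring. Qed.
Lemma mulqDl : left_distributive mulq +%R.
Proof. by move=> p q s; apply: quatP => /=; ring. Qed.
Lemma mulqDr : right_distributive mulq +%R.
Proof. by move=> p q s; apply: quatP => /=; ring. Qed.
Lemma quat1_neq0 : quat1 != 0.
Proof. by apply/eqP => -[] /eqP; rewrite oner_eq0. Qed.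

HB.instance Definition _ := GRing.Zmodule_isNzRing.Build (quat R)
  mulqA mul1q mulq1 mulqDl mulqDr quat1_neq0.

Lemma scaleqA a b q : scaleq a (scaleq b q) = scaleq (a * b) q.
Proof. by apply: quatP => /=; ring. Qed.
Lemma scale1q : left_id 1 scaleq.
Proof. by move=> q; apply: quatP => /=; ring. Qed.
Lemma scaleqDr : right_distributive scaleq +%R.
Proof. by move=> a p q; apply: quatP => /=; ring. Qed.
Lemma scaleqDl q : {morph scaleq^~ q : a b / a + b}.
Proof. by move=> a b; apply: quatP => /=; ring. Qed.

HB.instance Definition _ := GRing.Zmodule_isLmodule.Build R (quat R)
  scaleqA scale1q scaleqDr scaleqDl.

Lemma scaleqAl a p q : a *: (p * q) = a *: p * q.
Proof. by apply: quatP => /=; ring. Qed.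
Lemma scaleqAr a p q : a *: (p * q) = p * (a *: q).
Proof. by apply: quatP => /=; ring. Qed.

HB.instance Definition _ := GRing.Lmodule_isLalgebra.Build R (quat R) scaleqAl.
HB.instance Definition _ := GRing.Lalgebra_isAlgebra.Build R (quat R) scaleqAr.

Lemma qdot_ge0 q : 0 <= qdot q q.
Proof. by rewrite /qdot -!expr2 !addr_ge0 ?sqr_ge0. Qed.

Lemma qdot_eq0 q : qdot q q = 0 -> q = 0.
Proof.
rewrite /qdot -!expr2 => /eqP.
rewrite !paddr_eq0 ?addr_ge0 ?sqr_ge0// !sqrf_eq0.
by move=> /andP[/andP[/andP[/eqP ? /eqP ?] /eqP ?] /eqP ?]; exact: quatP.
Qed.

Lemma qdot_neq0 q : q != 0 -> qdot q q != 0.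
Proof. by apply: contra => /eqP/qdot_eq0/eqP. Qed.

Lemma mulVq : {in [pred q : quat R | q != 0], left_inverse 1 invq *%R}.
Proof.
move=> q /qdot_neq0 q0; rewrite /invq; apply: quatP => /=;
  move: q0; rewrite /qdot => q0; by field.
Qed.

Lemma mulqV : {in [pred q : quat R | q != 0], right_inverse 1 invq *%R}.
Proof.
move=> q /qdot_neq0 q0; rewrite /invq; apply: quatP => /=;
  move: q0; rewrite /qdot => q0; by field.
Qed.

Lemma unitq p q : q * p = 1 /\ p * q = 1 -> p != 0.
Proof.
move=> [+ _]; apply: contra_eq_neq => ->.
by rewrite mulr0 eq_sym oner_neq0.
Qed.

Lemma invq_out : {in [predC [pred q : quat R | q != 0]], invq =1 id}.
Proof.
move=> q; rewrite !inE negbK => /eqP ->.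
by apply: quatP => /=; ring.
Qed.

HB.instance Definition _ := GRing.NzRing_hasMulInverse.Build (quat R)
  mulVq mulqV unitq invq_out.

Lemma qdot_le p q : qdot p q <= qnorm p * qnorm q.
Proof.
rewrite /qnorm -sqrtrM ?qdot_ge0//.
apply: (le_trans (ler_norm _)); rewrite -sqrtr_sqr ler_wsqrtr//.
rewrite -subr_ge0.
have -> : qdot p p * qdot q q - qdot p q ^+ 2 =
    (qre p * qi q - qi p * qre q) ^+ 2 + (qre p * qj q - qj p * qre q) ^+ 2 +
    (qre p * qk q - qk p * qre q) ^+ 2 + (qi p * qj q - qj p * qi q) ^+ 2 +
    (qi p * qk q - qk p * qi q) ^+ 2 + (qj p * qk q - qk p * qj q) ^+ 2.
  by rewrite /qdot; ring.
by rewrite !addr_ge0 ?sqr_ge0.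
Qed.

Lemma ler_qnormD p q : qnorm (p + q) <= qnorm p + qnorm q.
Proof.
have n0 s : 0 <= qnorm s by exact: sqrtr_ge0.
rewrite -(@ler_pXn2r _ 2) ?nnegrE ?addr_ge0// [leLHS]sqr_sqrtr ?qdot_ge0//.
rewrite sqrrD !sqr_sqrtr ?qdot_ge0//.
have -> : qdot (p + q) (p + q) = qdot p p + qdot p q *+ 2 + qdot q q.
  by rewrite /qdot /=; ring.
by rewrite lerD2r lerD2l lerMn2r qdot_le.
Qed.

Lemma qnormZ a q : qnorm (a *: q) = `|a| * qnorm q.
Proof.
rewrite /qnorm -sqrtr_sqr -sqrtrM ?sqr_ge0//; congr Num.sqrt.
by rewrite /qdot /=; ring.
Qed.

Lemma qnorm_eq0 q : qnorm q = 0 -> q = 0.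
Proof.
move=> /eqP; rewrite sqrtr_eq0 => q0; apply: qdot_eq0.
by apply/eqP; rewrite eq_le q0 qdot_ge0.
Qed.

HB.instance Definition _ := Lmodule_isNormed.Build R (quat R)
  ler_qnormD qnormZ qnorm_eq0.

Lemma normqE q : `|q| = qnorm q. Proof. by []. Qed.

End quaternion_algebra.

Section slice_regular.
Variable R : realType.
Implicit Types (r : R) (q I J : quat R) (f g F G : quat R -> quat R).

Definition qball r : set (quat R) := [set q | `|q| < r].

Definition qsphere : set (quat R) := [set q | q ^+ 2 = -1].

Definition qslice I : set (quat R) :=
  [set q | exists x y : R, q = x%:A + y *: I].

Definition qdisc r I : set (quat R) := qball r `&` qslice I.

(** On [qslice I], the partial derivatives of [fun x y => f (x + y I)] are the
    directional derivatives of [f] along [1] and [I]; at a point of the disc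
    they only depend on the restriction of [f] to the disc, which is open in
    the slice. *)
Definition slice_regular r f := forall I, qsphere I ->
  [/\ forall q, qdisc r I q -> derivable f q 1 /\ derivable f q I,
      {within qdisc r I, continuous ('D_1 f)},
      {within qdisc r I, continuous ('D_I f)} &
      forall q, qdisc r I q -> 2^-1 *: ('D_1 f q + I * 'D_I f q) = 0].

(** A function [B(0, r) -> H] is represented by its extension by zero. *)
Definition slice_reg_pred r : {pred quat R -> quat R} :=
  [pred f | `[< slice_regular r f /\ forall q, ~ qball r q -> f q = 0 >]].

Lemma slice_regular0 r : slice_regular r 0.
Proof.
have D0 v : 'D_v (0 : quat R -> quat R) = cst 0.
  by apply/funext => q; rewrite -[0]/(cst 0) derive_cst.
move=> I _; split.
- by move=> q _; split; exact: derivable_cst.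
- by rewrite D0 => q; exact: cvg_cst.
- by rewrite D0 => q; exact: cvg_cst.
- by move=> q _; rewrite -[0]/(cst 0) !derive_cst mulr0 addr0 scaler0.
Qed.

Lemma within_derive_lin r I (a : R) f g v :
  (forall q, qdisc r I q -> derivable f q v) ->
  (forall q, qdisc r I q -> derivable g q v) ->
  {within qdisc r I, continuous ('D_v f)} ->
  {within qdisc r I, continuous ('D_v g)} ->
  {within qdisc r I, continuous ('D_v (a *: f + g))}.
Proof.
move=> df dg cf cg.
apply: (@subspace_eq_continuous _ _ _ (a *: 'D_v f + 'D_v g)).
  move=> q; rewrite inE => qD; apply/esym.
  have e1 : 'D_v (a *: f + g) q = 'D_v (a *: f) q + 'D_v g q.
    by apply: deriveD; [apply: derivableZ; exact: df|exact: dg].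
  by rewrite [LHS]e1 deriveZ//; exact: df.
by move=> q; apply: cvgD; [apply: cvgZl_tmp; exact: cf|exact: cg].
Qed.

Lemma slice_regular_lin r (a : R) f g :
  slice_regular r f -> slice_regular r g -> slice_regular r (a *: f + g).
Proof.
move=> rf rg I SI; have [df f1 fI f0] := rf I SI; have [dg g1 gI g0] := rg I SI.
split.
- move=> q qD; have [? ?] := df q qD; have [? ?] := dg q qD.
  by split; (apply: derivableD => //; exact: derivableZ).
- by apply: within_derive_lin => // q qD;
    [have [] := df q qD|have [] := dg q qD].
- by apply: within_derive_lin => // q qD;
    [have [] := df q qD|have [] := dg q qD].
- move=> q qD; have [? ?] := df q qD; have [? ?] := dg q qD.
  rewrite !deriveD//; try exact: derivableZ.
  rewrite !deriveZ// mulrDr -scalerAr addrACA -scalerDr [LHS]scalerDr g0//.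
  by rewrite addr0 scalerA mulrC -scalerA f0// scaler0.
Qed.

Lemma slice_reg_submod_closed r : submod_closed (slice_reg_pred r).
Proof.
split; first by apply/asboolP; split => //; exact: slice_regular0.
move=> a f g /asboolP[rf zf] /asboolP[rg zg]; apply/asboolP; split.
  exact: slice_regular_lin.
move=> q qB; have -> : (a *: f + g) q = a *: f q + g q by [].
by rewrite (zf _ qB) (zg _ qB) scaler0 add0r.
Qed.

HB.instance Definition _ r := GRing.isSubmodClosed.Build R (quat R -> quat R)
  (slice_reg_pred r) (slice_reg_submod_closed r).

Record slice_fun r := SliceFun {
  slice_fun_val :> quat R -> quat R;
  _ : slice_fun_val \in slice_reg_pred r }.

HB.instance Definition _ r := [isSub for @slice_fun_val r].
HB.instance Definition _ r := [Choice of slice_fun r by <:].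
HB.instance Definition _ r := [SubChoice_isSubLmodule of slice_fun r by <:].

(** Complex differentiability at every point of the disc; the difference
    quotient is taken inside the commutative field [qslice I], which is
    isomorphic to the complex numbers. *)
Definition disc_holomorphic r I F :=
  forall z, qdisc r I z -> exists d : quat R,
    h^-1 * (F (z + h) - F z) @[h --> within (qslice I) 0^'] --> d.

Definition disc_splitting r f I J F G :=
  [/\ disc_holomorphic r I F /\ disc_holomorphic r I G,
      forall z, qdisc r I z -> qslice I (F z),
      forall z, qdisc r I z -> qslice I (G z) &
      forall z, qdisc r I z -> f z = F z + G z * J].

Definition disc_sup r I F : \bar R :=
  ereal_sup [set (`|F z|)%:E | z in qdisc r I].

(** For [f] slice regular the set below is a singleton: a splitting exists for each [J], and the two
    suprema depend neither on [J] nor on the splitting. *)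
Definition slice_norm r f I : \bar R :=
  get [set n | exists J F G,
    [/\ qsphere J, qdot I J = 0, disc_splitting r f I J F G &
        n = sqrte (disc_sup r I F ^+ 2 + disc_sup r I G ^+ 2)%E]].

Definition sup_norm r (f : slice_fun r) : \bar R :=
  ereal_sup [set slice_norm r f I | I in qsphere].

End slice_regular.

(** Norm axioms for a function with values in [0, +oo]: an unbounded slice
    regular function, such as [(1 - q / r)^-1], has [sup_norm] equal to [+oo].
    The product [0 * +oo] is [0]. *)
Definition extended_norm (R : realType) (V : lmodType R) (N : V -> \bar R) :=
  [/\ forall v : V, (0 <= N v)%E,
      forall v : V, N v = 0%E <-> v = 0,
      forall (a : R) (v : V), N (a *: v) = (`|a|%:E * N v)%E &
      forall v w : V, (N (v + w)%R <= N v + N w)%E].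

(* Main.v *)
Require Import Defs.
From mathcomp Require Import all_boot all_order all_algebra.
From mathcomp Require Import ring lra.
From mathcomp Require Import all_classical all_reals all_analysis.

Import Order.TTheory GRing.Theory Num.Theory.
Import numFieldNormedType.Exports.
Local Open Scope classical_set_scope.
Local Open Scope ring_scope.

(** For [I] in the sphere, [P q = (q - I q I) / 2] is the orthogonal projection
    of [H] onto the plane [L_I], and [q - P q] lies in [L_I J].  Hence a
    splitting [f = F + G J] forces [F = P f] and [|G| = |f - P f|] on the disc,
    so the norm at [I] is the Euclidean norm of the pair
    [(sup |P f|, sup |f - P f|)].  Existence of the splitting is where
    regularity enters: continuity of the partial derivatives and the
    Cauchy-Riemann equation make [f] differentiable along the slice with
    differential [h |-> h * 'D_1 f z], and [P] commutes with left
    multiplication by [h] in [L_I].  Definiteness and the boundedness criterion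
    only use that the slices cover [H]. *)

Set Implicit Arguments.
Unset Strict Implicit.

(** * Quaternion arithmetic, unit imaginary quaternions and the planes [qslice I] *)

Section quaternions.
Variable R : realType.
Implicit Types (x y : R) (p q h I J : quat R).

Lemma quat_normE q : `|q| = qnorm q. Proof. by []. Qed.

Lemma qdotZr x p q : qdot p (x *: q) = x * qdot p q.
Proof. by rewrite /qdot /=; ring. Qed.

Lemma qdotBr p q s : qdot p (q - s) = qdot p q - qdot p s.
Proof. by rewrite /qdot /=; ring. Qed.

Lemma qdot_normr q : qdot q q = `|q| ^+ 2.
Proof. by rewrite quat_normE /qnorm sqr_sqrtr// qdot_ge0. Qed.

Lemma ler_norm_qdot p q : `|qdot p q| <= `|p| * `|q|.
Proof.
rewrite ler_norml qdot_le andbT lerNl.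
have -> : - qdot p q = qdot p (- q) by rewrite /qdot /=; ring.
by rewrite (le_trans (qdot_le _ _))// -!quat_normE normrN.
Qed.

Lemma normqM p q : `|p * q| = `|p| * `|q|.
Proof.
rewrite !quat_normE /qnorm -sqrtrM ?qdot_ge0//; congr Num.sqrt.
by rewrite /qdot /=; ring.
Qed.

Lemma normq1 : `|1 : quat R| = 1.
Proof. by rewrite quat_normE /qnorm /qdot /= !mulr0 !addr0 mulr1 sqrtr1. Qed.

Lemma normqV q : `|q^-1| = `|q|^-1.
Proof.
have [->|q0] := eqVneq q 0; first by rewrite invr0 normr0 invr0.
apply: (mulfI (_ : `|q| != 0)); first by rewrite normr_eq0.
by rewrite -normqM mulfV ?normr_eq0// divrr ?normq1.
Qed.

(** The imaginary parts of [I ^+ 2 = -1] say that twice the real part times each imaginary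
    coordinate vanishes. A nonzero real part would leave [I] real, with a negative square. *)
Lemma qsphereE I : qsphere I -> qre I = 0 /\ qdot I I = 1.
Proof.
case: I => a b c d; rewrite /qsphere /= expr2 => -[] /= e1 e2 e3 e4.
have [a0|a0] := eqVneq a 0; first by split => //; rewrite /qdot /=; nra.
have z u : a * u + u * a = 0 -> u = 0.
  move=> e; apply/eqP; rewrite -(mulrI_eq0 _ (lregP a0)).
  by apply/eqP; lra.
have b0 : b = 0 by apply: z; lra.
have c0 : c = 0 by apply: z; lra.
have d0 : d = 0 by apply: z; lra.
by subst; nra.
Qed.

Lemma qsphereP I : qre I = 0 -> qdot I I = 1 -> qsphere I.
Proof.
case: I => a b c d /= -> ; rewrite /qdot /= => e.
by apply: quatP => /=; lra.
Qed.

Lemma normq_sphere I : qsphere I -> `|I| = 1.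
Proof. by move=> /qsphereE[_ e]; rewrite quat_normE /qnorm e sqrtr1. Qed.

Lemma mulq_sphere I : qsphere I -> I * I = -1.
Proof. by rewrite /qsphere /= expr2. Qed.

(** For imaginary quaternions, [I * J + J * I] is the real number [- 2 * qdot I J]. *)
Lemma orth_anticomm I J : qsphere I -> qsphere J -> qdot I J = 0 ->
  I * J = - (J * I).
Proof.
case: I J => [a b c d] [a' b' c' d'] /qsphereE[/= -> _] /qsphereE[/= -> _].
by rewrite /qdot /= => e; apply: quatP => /=; lra.
Qed.

Lemma qsphere_nonempty : exists I : quat R, qsphere I.
Proof.
by exists (Quat 0 1 0 0); apply: qsphereP => //=; rewrite /qdot /=; ring.
Qed.

Lemma exists_orth I : qsphere I -> exists2 J, qsphere J & qdot I J = 0.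
Proof.
case: I => a b c d /qsphereE[/= -> e].
have [bc0|bc0] := eqVneq (b ^+ 2 + c ^+ 2) 0.
  exists (Quat 0 1 0 0).
    by apply: qsphereP => //=; rewrite /qdot /=; ring.
  move/eqP: bc0; rewrite paddr_eq0 ?sqr_ge0// !sqrf_eq0 => /andP[/eqP-> _].
  by rewrite /qdot /=; ring.
(* The rotated vector [(c, -b, 0)] is orthogonal to [(b, c, d)]; it degenerates only on the [k]
   axis, treated above. *)
pose J := Quat 0 c (- b) 0.
have J0 : J != 0.
  apply: contra bc0 => /eqP[-> /eqP]; rewrite oppr_eq0 => /eqP->.
  by apply/eqP; ring.
exists (`|J|^-1 *: J); last by rewrite qdotZr /qdot /=; ring.
apply: qsphereP; first by rewrite /= mulr0.
by rewrite qdot_normr normrZ normfV normr_id mulVf ?expr1n// normr_eq0.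
Qed.

Lemma qslice_comm I h : qslice I h -> I * h = h * I.
Proof.
by move=> [x [y ->]]; rewrite mulrDl mulrDr -!scalerAl -!scalerAr mulr1 mul1r.
Qed.

(** [I] is the normalised imaginary part of [q]; a real [q] lies in every slice, so any [I]
    serves. *)
Lemma qslice_decomp q : exists2 I, qsphere I & qslice I q.
Proof.
pose v := Quat 0 (qi q) (qj q) (qk q).
have qE : q = (qre q)%:A + v by apply: quatP => /=; ring.
have [v0|v0] := eqVneq v 0.
  have [I SI] := qsphere_nonempty; exists I => //; exists (qre q), 0.
  by rewrite scale0r -{1}v0.
exists (`|v|^-1 *: v).
  apply: qsphereP; first by rewrite /= mulr0.
  by rewrite qdot_normr normrZ normfV normr_id mulVf ?expr1n// normr_eq0.
by exists (qre q), `|v|; rewrite scalerA mulfV ?normr_eq0// scale1r.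
Qed.

Lemma qslice_coord_le I x y : qsphere I ->
  `|x| <= `|x%:A + y *: I| /\ `|y| <= `|x%:A + y *: I|.
Proof.
case: I => a b c d /qsphereE[/= -> e].
have E : qdot (x%:A + y *: Quat 0 b c d) (x%:A + y *: Quat 0 b c d) =
    x ^+ 2 + y ^+ 2.
  transitivity (x ^+ 2 + y ^+ 2 * qdot (Quat 0 b c d) (Quat 0 b c d)).
    by rewrite /qdot /=; ring.
  by rewrite e mulr1.
rewrite quat_normE /qnorm E -!sqrtr_sqr.
by split; rewrite ler_wsqrtr// ?lerDl ?lerDr sqr_ge0.
Qed.

(** The orthogonal projection of [quat R] onto the plane [qslice I]. *)
Definition slice_proj I q : quat R := 2^-1 *: (q - I * q * I).

Lemma slice_projD I : {morph slice_proj I : p q / p + q}.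
Proof.
by move=> p q; rewrite /slice_proj mulrDr mulrDl -scalerDr opprD addrACA.
Qed.

Lemma slice_projZ I x q : slice_proj I (x *: q) = x *: slice_proj I q.
Proof.
by rewrite /slice_proj -scalerAr -scalerAl -scalerBr !scalerA mulrC.
Qed.

Lemma norm_slice_proj I q : qsphere I -> `|slice_proj I q| <= `|q|.
Proof.
move=> SI; rewrite normrZ gtr0_norm ?invr_gt0// mulrC ler_pdivrMr//.
by rewrite (le_trans (ler_normB _ _))// !normqM normq_sphere//; lra.
Qed.

Lemma norm_slice_coproj I q : qsphere I -> `|q - slice_proj I q| <= `|q|.
Proof.
move=> SI; have -> : q - slice_proj I q = 2^-1 *: (q + I * q * I).
  by rewrite /slice_proj; apply: quatP => /=; lra.
rewrite normrZ gtr0_norm ?invr_gt0// mulrC ler_pdivrMr//.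
by rewrite (le_trans (ler_normD _ _))// !normqM normq_sphere//; lra.
Qed.

Lemma qslice_proj I q : qsphere I -> qslice I (slice_proj I q).
Proof.
case: I q => a b c d [q0 q1 q2 q3] /qsphereE[/= -> e].
(* The coordinate along [I] is the inner product of [q] with [I]. *)
exists q0, (b * q1 + c * q2 + d * q3); rewrite /slice_proj.
have E x : (0 * 0 + b * b + c * c + d * d) * x = x.
  by move: e; rewrite /qdot /= => ->; rewrite mul1r.
(* Multiplying [qdot I I = 1] by each coordinate of [q] supplies the cubic identities, which leave
   only linear reasoning. *)
have [E0 E1 E2 E3] := And4 (E q0) (E q1) (E q2) (E q3).
by apply: quatP => /=; lra.
Qed.

Lemma slice_projM I h q : qslice I h ->
  slice_proj I (h * q) = h * slice_proj I q.
Proof.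
move=> /qslice_comm hI.
by rewrite /slice_proj -scalerAr mulrBr !mulrA hI.
Qed.

Lemma slice_proj_id I q : qsphere I -> qslice I q -> slice_proj I q = q.
Proof.
move=> SI /qslice_comm qI; rewrite /slice_proj qI -mulrA mulq_sphere//.
by rewrite mulrN1 opprK; apply: quatP => /=; lra.
Qed.

(** Moving [I] past [q] and then [J] costs one sign, so [I * (q * J) * I = - (q * J * I * I) = q *
    J]. *)
Lemma slice_proj_orth I J q : qsphere I -> qsphere J -> qdot I J = 0 ->
  qslice I q -> slice_proj I (q * J) = 0.
Proof.
move=> SI SJ IJ /qslice_comm qI.
rewrite /slice_proj mulrA qI -!mulrA (mulrA I J I) (orth_anticomm SI SJ IJ).
by rewrite mulNr -mulrA (mulq_sphere SI) mulrN1 opprK subrr scaler0.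
Qed.

(** As [I] anticommutes with the orthogonal complement of [qslice I], the
    complementary component is a right multiple of [J]. *)
Lemma qslice_coproj I J q : qsphere I -> qsphere J -> qdot I J = 0 ->
  qslice I (- ((q - slice_proj I q) * J)).
Proof.
move=> SI SJ IJ.
have -> : - ((q - slice_proj I q) * J) = slice_proj I (- (q * J)).
  have JI : J * I = - (I * J) by rewrite (orth_anticomm SI SJ IJ) opprK.
  have IqJI : I * (q * J) * I = - (I * q * I * J) by rewrite -!mulrA JI !mulrN.
  rewrite /slice_proj mulrN mulNr IqJI mulrBl -scalerAl mulrBl.
  move: (q * J) (I * q * I * J) => s t.
  by apply: quatP => /=; lra.
exact: qslice_proj.
Qed.

End quaternions.

(** * Differentiability along a slice, and holomorphy of the components *)

Section slice_derivative.
Variable R : realType.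
Implicit Types (r x y e : R) (p q h z I J : quat R) (f : quat R -> quat R).

Lemma lipschitz_continuous (V W : normedModType R) (T : V -> W) (C : R) :
  (forall u v, `|T u - T v| <= C * `|u - v|) -> continuous T.
Proof.
move=> TC u; apply/cvgrPdist_le => e e0.
(* [C] has no assumed sign and may vanish; the larger constant can be divided by. *)
have C0 : 0 < `|C| + 1 by rewrite ltr_wpDl.
near=> v; apply: (le_trans (TC _ _)).
apply: (@le_trans _ _ ((`|C| + 1) * `|u - v|)).
  by rewrite ler_wpM2r// (le_trans (ler_norm _))// lerDl.
rewrite mulrC -ler_pdivlMr//.
near: v; exact: cvgr_dist_le (@cvg_id _ _) _ (divr_gt0 e0 C0).
Unshelve. all: by end_near. Qed.

Lemma qdot_continuous q : continuous (qdot q).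
Proof.
apply: (@lipschitz_continuous _ _ _ `|q|) => u v.
by rewrite -qdotBr; exact: ler_norm_qdot.
Qed.

(** Pairing with a fixed [u] gives a real function of one real variable, to which the mean value
    theorem applies. *)
Lemma is_derive_qdot_line (u z v D : quat R) f (s : R) :
  derivable f (z + s *: v) v ->
  is_derive s 1 (fun t : R => qdot u (f (z + t *: v) - t *: D))
    (qdot u ('D_v f (z + s *: v) - D)).
Proof.
move=> df.
pose g t := qdot u (f (z + t *: v) - t *: D).
have gcvg : h^-1 *: ((g \o shift s) (h *: 1) - g s) @[h --> 0^'] -->
    qdot u ('D_v f (z + s *: v) - D).
  have lim_f : h^-1 *: ((f \o shift (z + s *: v)) (h *: v) - f (z + s *: v)) - D
      @[h --> (0 : R)^'] --> 'D_v f (z + s *: v) - D.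
    by apply: cvgB; [exact: df|exact: cvg_cst].
  apply: cvg_trans (continuous_cvg _ (@qdot_continuous u _) lim_f).
  apply: near_eq_cvg; near=> h.
  have h0 : h != 0 by near: h; exact: nbhs_dnbhs_neq.
  rewrite /g /= -qdotBr; apply: etrans (qdotZr _ _ _); congr qdot.
  have hA : h *: (1 : R) = h by exact: mulr1.
  rewrite hA addrCA -scalerDl scalerBr scalerBr scalerBr !scalerDl scalerDr.
  rewrite !scalerA (mulVf h0) scale1r.
  by apply: quatP => /=; ring.
split; first by apply/cvg_ex; eexists; exact: gcvg.
exact: cvg_lim gcvg.
Unshelve. all: by end_near. Qed.

(** Applying the scalar mean value theorem to the inner product with the
    increment [u] itself bounds [`|u| ^+ 2] by [`|t| * `|u| * e]. *)
Lemma mean_value_dist f (z v D : quat R) e (t : R) :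
  (forall s : R, `|s| <= `|t| -> derivable f (z + s *: v) v /\
     `|'D_v f (z + s *: v) - D| <= e) ->
  `|f (z + t *: v) - f z - t *: D| <= `|t| * e.
Proof.
move=> H; set u := (X in `|X| <= _).
pose g s := qdot u (f (z + s *: v) - s *: D).
pose dg s := qdot u ('D_v f (z + s *: v) - D).
have gP (s : R) : `|s| <= `|t| -> is_derive s 1 g (dg s).
  by move=> /H[df _]; exact: is_derive_qdot_line.
have [s st gE] : exists2 s, `|s| <= `|t| & g t - g 0 = dg s * t.
  have gc (a b : R) : `|a| <= `|t| -> `|b| <= `|t| ->
      {within `[a, b], continuous g}.
    move=> /ler_normlP[? ?] /ler_normlP[? ?].
    apply: derivable_within_continuous => x; rewrite in_itv/= => /andP[ax xb].
    have /gP[] // : `|x| <= `|t| by rewrite ler_norml; lra.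
  have [t0|t0] := leP 0 t.
    have [s||s + gE] := @MVT_segment R g dg 0 t t0.
    - rewrite in_itv/= => /andP[s0 sT]; apply: gP.
      by rewrite !ger0_norm// ltW.
    - by apply: gc; rewrite ?normr0.

    rewrite in_itv/= => /andP[s0 sT]; exists s; last by rewrite gE subr0.
    by rewrite !ger0_norm.
  have [s|| s + gE] := @MVT_segment R g dg t 0 (ltW t0).
  - rewrite in_itv/= => /andP[s0 sT]; apply: gP.
    by rewrite !ler0_norm ?lerN2 ltW.
  - by apply: gc; rewrite ?normr0.
  rewrite in_itv/= => /andP[s0 sT]; exists s.
    by rewrite !ler0_norm ?lerN2// ltW.
  by rewrite -opprB gE sub0r mulrN opprK.
have uE : g t - g 0 = `|u| ^+ 2.
  rewrite -qdot_normr /g -qdotBr; congr qdot.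
  by rewrite !scale0r addr0 subr0 /u addrAC.
have [->|u0] := eqVneq `|u| 0.
  (* The hypothesis at [s = 0] forces [e] to be nonnegative. *)
  have [|_ le_e] := H 0; first by rewrite normr0.
  by rewrite mulr_ge0// (le_trans _ le_e).
have {}u0 : 0 < `|u| by rewrite lt_def u0 normr_ge0.
rewrite -(ler_pM2l u0) -expr2 -uE gE (le_trans (ler_norm _))// normrM.
rewrite mulrCA mulrC.
rewrite ler_wpM2l// (le_trans (ler_norm_qdot _ _))// ler_wpM2l//.
by have [] := H _ st.
Qed.

Lemma qdisc0 r I : 0 < r -> qdisc r I 0.
Proof.
move=> r0; split; first by rewrite /qball /= normr0.
by exists 0, 0; rewrite !scale0r addr0.
Qed.

Lemma within_qdisc_dist r I z e (g : quat R -> quat R) : 0 < e -> qdisc r I z ->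
  {within qdisc r I, continuous g} ->
  exists2 d, 0 < d & forall q, `|q| < d -> qslice I q ->
    qdisc r I (z + q) /\ `|g (z + q) - g z| <= e.
Proof.
move=> e0 [zr [x [y zE]]] /subspace_continuousP gc.
have zD : qdisc r I z by split => //; exists x, y.
have /cvgrPdist_le/(_ _ e0) := gc _ zD.
rewrite near_withinE => /nbhs_normP[d d0 dP].
(* The second bound keeps [z + q] in the ball, where the relative continuity of [g] applies. *)
exists (Num.min d (r - `|z|)); first by rewrite lt_min d0 subr_gt0.
move=> q; rewrite lt_min => /andP[qd qr] [x' [y' qE]].
have D : qdisc r I (z + q).
  split; last by exists (x + x'), (y + y'); rewrite zE qE !scalerDl addrACA.
  by rewrite /qball /= (le_lt_trans (ler_normD _ _))// -ltrBrDl.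
split => //; rewrite distrC; apply: dP => //.
by rewrite /ball_ /= opprD addNKr normrN.
Qed.

(** Go from [z] to [z + h] by a leg along [1] and then a leg along [I], and apply the mean value
    estimate to each. Both legs are at most [|h|] long, so an error [e / 2] per leg suffices. *)
Lemma slice_regular_differential r f I z e : slice_regular r f -> qsphere I ->
  qdisc r I z -> 0 < e ->
  exists2 d, 0 < d & forall h, `|h| < d -> qslice I h ->
    `|f (z + h) - f z - h * 'D_1 f z| <= e * `|h|.
Proof.
move=> rf SI zD e0; have [df c1 cI CR] := rf I SI.
have e20 : 0 < e / 2 by rewrite divr_gt0.
have [d1 d10 P1] := within_qdisc_dist e20 zD c1.
have [d2 d20 P2] := within_qdisc_dist e20 zD cI.
(* Points of the two legs are within [|x| + |y| <= 2 * |h|] of [z], hence the halving. *)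
exists (Num.min d1 d2 / 2); first by rewrite divr_gt0// lt_min d10.
move=> h hd [x [y hE]].
have [xh yh] := qslice_coord_le x y SI; rewrite -hE in xh yh.
(* The Cauchy-Riemann equation multiplied by [I] turns [x *: 'D_1 f z + y *: 'D_I f z] into
   [h * 'D_1 f z]. *)
have DI : 'D_I f z = I * 'D_1 f z.
  have /eqP := CR z zD.
  rewrite scaler_eq0 invr_eq0 pnatr_eq0/= addr_eq0 => /eqP->.
  by rewrite mulrN mulrA (mulq_sphere SI) mulN1r opprK.
have near_z (s t : R) : `|s| <= `|x| -> `|t| <= `|y| ->
    `|s%:A + t *: I| < d1 /\ `|s%:A + t *: I| < d2.
  move=> sx ty; apply/andP; rewrite -lt_min.
  rewrite (le_lt_trans (ler_normD _ _))// !normrZ normq1 (normq_sphere SI).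
  by lra.
have step1 : `|f (z + x *: 1) - f z - x *: 'D_1 f z| <= `|x| * (e / 2).
  apply: mean_value_dist => s sx.
  have [sd _] := near_z s 0 sx ltac:(by rewrite normr0).
  rewrite scale0r addr0 in sd.
  have [|sD sle] := P1 _ sd; first by exists s, 0; rewrite scale0r addr0.
  by split => //; have [] := df _ sD.
have step2 : `|f (z + x *: 1 + y *: I) - f (z + x *: 1) - y *: 'D_I f z|
    <= `|y| * (e / 2).
  apply: mean_value_dist => s sy.
  have [_ sd] := near_z x s (lexx _) sy.
  have [|sD sle] := P2 _ sd; first by exists x, s.
  by rewrite -addrA; split => //; have [] := df _ sD.
have -> : f (z + h) - f z - h * 'D_1 f z =
    (f (z + x *: 1 + y *: I) - f (z + x *: 1) - y *: 'D_I f z) +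
    (f (z + x *: 1) - f z - x *: 'D_1 f z).
  have -> : z + x *: 1 + y *: I = z + h by rewrite hE addrA.
  have -> : h * 'D_1 f z = x *: 'D_1 f z + y *: 'D_I f z.
    by rewrite hE mulrDl -!scalerAl mul1r DI.
  by apply: quatP => /=; ring.
rewrite (le_trans (ler_normD _ _))//.
rewrite (le_trans (lerD step2 step1))// -mulrDl mulrA ler_pdivrMr//.
by nra.
Qed.

(** A bounded additive [T] that commutes with left multiplication by [qslice I] carries the
    differential over. The general [T] covers both components of the splitting. *)
Lemma slice_regular_holomorphic r f I T (C : R) : slice_regular r f ->
  qsphere I -> 0 <= C -> {morph T : p q / p - q} ->
  (forall h q, qslice I h -> T (h * q) = h * T q) ->
  (forall q, `|T q| <= C * `|q|) ->
  disc_holomorphic r I (T \o f).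
Proof.
move=> rf SI C0 TB TM TC z zD; exists (T ('D_1 f z)).
apply/cvgrPdist_le => e e0.
have C1 : 0 < C + 1 by rewrite ltr_wpDl.
have [d d0 dP] := slice_regular_differential rf SI zD (divr_gt0 e0 C1).
rewrite near_withinE; near=> h => hI.
have h0 : h != 0 by near: h; exact: nbhs_dnbhs_neq.
have hd : `|h| < d by near: h; apply: dnbhs0_lt.
(* The error of the quotient is [T] of the first-order remainder divided by [h]. *)
have -> : T ('D_1 f z) - h^-1 * ((T \o f) (z + h) - (T \o f) z) =
    - (h^-1 * T (f (z + h) - f z - h * 'D_1 f z)).
  rewrite /= -TB [in RHS]TB TM// [in RHS]mulrBr mulrA mulVr//.
  by rewrite mul1r opprB.
rewrite normrN normqM normqV mulrC ler_pdivrMr ?normr_gt0//.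
rewrite (le_trans (TC _))// (le_trans (ler_wpM2l C0 (dP _ hd hI)))//.
rewrite mulrA ler_wpM2r// mulrA ler_pdivrMr// mulrC ler_wpM2l ?ltW//.
by rewrite ltrDl.
Unshelve. all: by end_near. Qed.

End slice_derivative.

(** * Euclidean norm of a pair of extended reals *)

Section slice_norm.
Variable R : realType.
Implicit Types (a b c d : \bar R) (f F G : quat R -> quat R) (I J : quat R).

Definition hypote a b : \bar R := sqrte (a ^+ 2 + b ^+ 2)%E.

(** Viewing the pair as a quaternion reduces Minkowski's inequality to the triangle inequality
    already known there. *)
Lemma hypote_fin (x y : R) : hypote x%:E y%:E = `|Quat x y 0 0|%:E.
Proof.
rewrite /hypote -!EFin_expe -EFinD /= quat_normE /qnorm /qdot /=.
by rewrite !mulr0 !addr0 -!expr2.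
Qed.

Lemma hypote_pinftyl b : hypote +oo%E b = +oo%E.
Proof.
by rewrite /hypote expe2 mulyy addye// gt_eqF// (lt_le_trans _ (sqre_ge0 b)).
Qed.

Lemma hypoteC a b : hypote a b = hypote b a.
Proof. by rewrite /hypote addeC. Qed.

Lemma hypoteD a b c d : (0 <= a -> 0 <= b -> 0 <= c -> 0 <= d ->
  hypote (a + c) (b + d) <= hypote a b + hypote c d)%E.
Proof.
have topl x y z : (z <= +oo + hypote x y)%E.
  by rewrite addye ?leey// gt_eqF// (lt_le_trans _ (sqrte_ge0 _)).
case: a => [a||] // _; last by rewrite (hypote_pinftyl b).
case: b => [b||] // _.
case: c => [c||] // _; last by rewrite (addeC (hypote _ _)) (hypote_pinftyl d).
case: d => [d||] // _.
rewrite !hypote_fin.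
have -> : Quat (a + c) (b + d) 0 0 = Quat a b 0 0 + Quat c d 0 0.
  by apply: quatP => /=; rewrite ?addr0.
exact: ler_normD.
Qed.

Lemma hypoteZ (x : R) a b : (0 <= a -> 0 <= b -> 0 <= x%:E ->
  hypote (x%:E * a) (x%:E * b) = x%:E * hypote a b)%E.
Proof.
move=> a0 b0 x0; rewrite /hypote !expe2 (muleACA x%:E a) (muleACA x%:E b).
rewrite -ge0_muleDr ?mule_ge0//.
by rewrite sqrteM ?mule_ge0// -expe2 sqrte_sqr gee0_abs.
Qed.

Lemma le_hypotel a b : (0 <= a -> 0 <= b -> a <= hypote a b)%E.
Proof.
move=> a0 b0; rewrite -[leLHS]gee0_abs// -sqrte_sqr.
rewrite lee_sqrt ?adde_ge0 ?sqre_ge0//.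
by rewrite leeDl// sqre_ge0.
Qed.

Lemma le_hypoter a b : (0 <= a -> 0 <= b -> b <= hypote a b)%E.
Proof. by move=> a0 b0; rewrite hypoteC le_hypotel. Qed.

Lemma le_hypote a b c d : (0 <= a -> 0 <= b -> a <= c -> b <= d ->
  hypote a b <= hypote c d)%E.
Proof.
move=> a0 b0 ac bd; rewrite lee_sqrt ?adde_ge0 ?sqre_ge0// leeD// !expe2.
  exact: lee_pmul.
exact: lee_pmul.
Qed.

(** Minkowski's inequality for [(a, 0) + (0, b)]. *)
Lemma hypote_le a b : (0 <= a -> 0 <= b -> hypote a b <= a + b)%E.
Proof.
move=> a0 b0; have := hypoteD a0 (lexx 0%E) (lexx 0%E) b0.
rewrite adde0 add0e => /le_trans; apply.
have sq0 : (0 ^+ 2 = 0 :> \bar R)%E by rewrite expe2 mule0.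
by rewrite /hypote sq0 adde0 add0e !sqrte_sqr !gee0_abs.
Qed.

(** * Suprema over a disc and the value of the slice norm *)

Variable r : R.
Hypothesis r_gt0 : 0 < r.

Lemma le_disc_sup I F z : qdisc r I z -> (`|F z|%:E <= disc_sup r I F)%E.
Proof. by move=> zD; apply: ereal_sup_ubound; exists z. Qed.

Lemma disc_sup_le I F a : (forall z, qdisc r I z -> (`|F z|%:E <= a)%E) ->
  (disc_sup r I F <= a)%E.
Proof. by move=> H; apply: ge_ereal_sup => _ [z zD <-]; exact: H. Qed.

(** The disc contains [0] because [r] is positive; an empty supremum would be [-oo]. *)
Lemma disc_sup_ge0 I F : (0 <= disc_sup r I F)%E.
Proof.
by apply: le_trans (le_disc_sup F (qdisc0 I r_gt0)); rewrite lee_fin.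
Qed.

Lemma eq_disc_sup I F G :
  (forall z, qdisc r I z -> `|F z| = `|G z|) -> disc_sup r I F = disc_sup r I G.
Proof.
move=> FG; apply/eqP; rewrite eq_le; apply/andP; split;
  apply: disc_sup_le => z zD; [rewrite FG//|rewrite -FG//]; exact: le_disc_sup.
Qed.

Lemma disc_supD I F G :
  (disc_sup r I (F \+ G)%R <= disc_sup r I F + disc_sup r I G)%E.
Proof.
apply: disc_sup_le => z zD.
apply: (@le_trans _ _ (`|F z|%:E + `|G z|%:E)%E).
  by rewrite -EFinD lee_fin ler_normD.
by rewrite leeD// le_disc_sup.
Qed.

Lemma disc_supZ I F (x : R) :
  disc_sup r I (x \*: F)%R = (`|x|%:E * disc_sup r I F)%E.
Proof.
(* Nonemptiness matters at [x = 0]: an empty supremum [-oo] is not preserved by multiplication by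
   [0]. *)
rewrite /disc_sup -ereal_supZl//; last first.
  by apply/set0P; exists `|F 0|%:E, 0 => //; exact: qdisc0.
rewrite image_comp; congr ereal_sup; apply: eq_imagel => z _ /=.
by rewrite normrZ.
Qed.

Definition proj_sup I f := disc_sup r I (slice_proj I \o f).
Definition coproj_sup I f := disc_sup r I (fun z => f z - slice_proj I (f z)).

(** The second component solves [G * J = f - P f] using [J^-1 = - J]. Both components are images of
    [f] under slice-linear maps of norm at most [1]. *)
Lemma slice_splitting f I J : slice_regular r f -> qsphere I -> qsphere J ->
  qdot I J = 0 ->
  disc_splitting r f I J (slice_proj I \o f)
    (fun z => - ((f z - slice_proj I (f z)) * J)).
Proof.
move=> rf SI SJ IJ.
have projB : {morph slice_proj I : p q / p - q}.
  by move=> p q; rewrite slice_projD -scaleN1r slice_projZ scaleN1r.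
split.
- split.
    apply: (@slice_regular_holomorphic _ _ _ _ _ 1) => // [h q|q].
      exact: slice_projM.
    by rewrite mul1r norm_slice_proj.
  pose T q := - ((q - slice_proj I q) * J).
  apply: (@slice_regular_holomorphic _ _ _ _ T 1) => // [p q|h q hI|q].
  + rewrite /T projB -opprD -mulrBl; congr (- (_ * _)).
    by apply: quatP => /=; ring.
  + by rewrite /T slice_projM// -mulrBr -mulrA mulrN.
  + by rewrite mul1r normrN normqM (normq_sphere SJ) mulr1 norm_slice_coproj.
- by move=> z _; exact: qslice_proj.
- by move=> z _; exact: qslice_coproj.
- move=> z _ /=; rewrite mulNr -mulrA (mulq_sphere SJ) mulrN1 opprK.
  by rewrite addrC subrK.
Qed.

Lemma disc_splitting_sup f I J F G : qsphere I -> qsphere J -> qdot I J = 0 ->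
  disc_splitting r f I J F G ->
  disc_sup r I F = proj_sup I f /\ disc_sup r I G = coproj_sup I f.
Proof.
move=> SI SJ IJ [_ FI GI fE].
have PE z : qdisc r I z -> slice_proj I (f z) = F z.
  move=> zD; rewrite fE// slice_projD slice_proj_id ?slice_proj_orth ?addr0//;
    by [exact: FI|exact: GI].
split; apply: eq_disc_sup => z zD; first by rewrite /= PE.
by rewrite PE// fE// addrC addKr normqM (normq_sphere SJ) mulr1.
Qed.

(** The set under [get] is a singleton: the projection splitting for an orthogonal [J] inhabits it,
    and every splitting yields the same two suprema. *)
Lemma slice_normE f I : slice_regular r f -> qsphere I ->
  slice_norm r f I = hypote (proj_sup I f) (coproj_sup I f).
Proof.
move=> rf SI; have [J SJ IJ] := exists_orth SI.
have spl := slice_splitting rf SI SJ IJ.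
apply: get_unique.
  have [<- <-] := disc_splitting_sup SI SJ IJ spl.
  by exists J; do 2 eexists; split; [| |exact: spl|].
move=> n [J' [F [G [SJ' IJ' splFG ->]]]].
by have [-> ->] := disc_splitting_sup SI SJ' IJ' splFG.
Qed.

(** * Norm axioms on each slice, then for the supremum over slices *)

Implicit Types (v w : slice_fun r).

Lemma slice_fun_regular v : slice_regular r v.
Proof. by case: v => f /= /asboolP[]. Qed.

Lemma slice_fun_out v q : ~ qball r q -> v q = 0.
Proof. by case: v => f /= /asboolP[_]; exact. Qed.

Lemma proj_supD I v w :
  (proj_sup I (v + w)%R <= proj_sup I v + proj_sup I w)%E.
Proof.
apply: le_trans (disc_supD _ _ _).
rewrite /proj_sup le_eqVlt; apply/orP; left; apply/eqP.
by apply: eq_disc_sup => z _ /=; rewrite -slice_projD.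
Qed.

Lemma coproj_supD I v w :
  (coproj_sup I (v + w)%R <= coproj_sup I v + coproj_sup I w)%E.
Proof.
apply: le_trans (disc_supD _ _ _).
rewrite /coproj_sup le_eqVlt; apply/orP; left; apply/eqP.
apply: eq_disc_sup => z _ /=.
by rewrite addrACA -opprD -slice_projD.
Qed.

Lemma slice_fun_normE v I : qsphere I ->
  slice_norm r v I = hypote (proj_sup I v) (coproj_sup I v).
Proof. by move=> SI; rewrite slice_normE//; exact: slice_fun_regular. Qed.

Lemma slice_norm_ge0 v I : qsphere I -> (0 <= slice_norm r v I)%E.
Proof. by move=> SI; rewrite slice_fun_normE// sqrte_ge0. Qed.

Lemma slice_normD v w I : qsphere I ->
  (slice_norm r (v + w)%R I <= slice_norm r v I + slice_norm r w I)%E.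
Proof.
move=> SI; rewrite 3?(slice_fun_normE _ SI).
apply: le_trans (hypoteD _ _ _ _); rewrite ?disc_sup_ge0//.
by rewrite le_hypote ?disc_sup_ge0 ?proj_supD ?coproj_supD.
Qed.

Lemma slice_normZ (x : R) v I : qsphere I ->
  (slice_norm r (x *: v)%R I = `|x|%:E * slice_norm r v I)%E.
Proof.
move=> SI; rewrite 2?(slice_fun_normE _ SI).
rewrite -hypoteZ ?disc_sup_ge0 ?lee_fin//; congr hypote; rewrite -disc_supZ;
  apply: eq_disc_sup => z _ /=.
  by rewrite -slice_projZ.
by rewrite scalerBr -slice_projZ.
Qed.

(** Each of the two components of [v q] is bounded by the slice norm. The factor two is crude but
    enough for definiteness and finiteness. *)
Lemma norm_le_slice_norm v I q : qsphere I -> qdisc r I q ->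
  (`|v q|%:E <= slice_norm r v I + slice_norm r v I)%E.
Proof.
move=> SI qD; rewrite slice_fun_normE//.
have P0 : (0 <= proj_sup I v)%E := disc_sup_ge0 I _.
have Q0 : (0 <= coproj_sup I v)%E := disc_sup_ge0 I _.
apply: le_trans (leeD (le_hypotel P0 Q0) (le_hypoter P0 Q0)).
apply: le_trans (leeD (le_disc_sup _ qD) (le_disc_sup _ qD)).
rewrite -EFinD lee_fin -[in leLHS](subrK (slice_proj I (v q)) (v q)) addrC.
exact: ler_normD.
Qed.

Lemma slice_norm_le v I (M : R) : qsphere I ->
  (forall q, qball r q -> `|v q| <= M) -> (slice_norm r v I <= (M + M)%:E)%E.
Proof.
move=> SI vM; rewrite slice_fun_normE//.
apply: (le_trans (hypote_le (disc_sup_ge0 I _) (disc_sup_ge0 I _))).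
rewrite EFinD leeD//; apply: disc_sup_le => z [/vM zM _]; rewrite lee_fin.
  by rewrite (le_trans (norm_slice_proj _ SI)).
by rewrite (le_trans (norm_slice_coproj _ SI)).
Qed.

Lemma slice_norm_le_sup_norm v I : qsphere I ->
  (slice_norm r v I <= sup_norm v)%E.
Proof. by move=> SI; apply: ereal_sup_ubound; exists I. Qed.

Lemma sup_norm_le v a : (forall I, qsphere I -> (slice_norm r v I <= a)%E) ->
  (sup_norm v <= a)%E.
Proof. by move=> H; apply: ge_ereal_sup => _ [I SI <-]; exact: H. Qed.

Lemma sup_norm_ge0 v : (0 <= sup_norm v)%E.
Proof.
have [I SI] := qsphere_nonempty R.
exact: le_trans (slice_norm_ge0 v SI) (slice_norm_le_sup_norm v SI).
Qed.

Lemma norm_le_sup_norm v q : qball r q ->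
  (`|v q|%:E <= sup_norm v + sup_norm v)%E.
Proof.
move=> qB; have [I SI qI] := qslice_decomp q.
apply: le_trans (norm_le_slice_norm v SI (conj qB qI)) _.
by rewrite leeD// slice_norm_le_sup_norm.
Qed.

Lemma sup_norm_eq0 v : sup_norm v = 0%E <-> v = 0.
Proof.
split=> [v0|->].
  apply: val_inj; apply/funext => q /=.
  (* Equality of total functions also concerns points outside the ball, where the extension by zero
     decides. *)
  have [qB|/slice_fun_out->//] := pselect (qball r q).
  have := norm_le_sup_norm v qB.
  by rewrite v0 adde0 lee_fin normr_le0 => /eqP.
apply/eqP; rewrite eq_le sup_norm_ge0 andbT; apply: sup_norm_le => I SI.
have := @slice_norm_le 0 I 0 SI; rewrite addr0; apply => q _.
by rewrite normr0.
Qed.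

Lemma sup_normZ (x : R) v : sup_norm (x *: v) = (`|x|%:E * sup_norm v)%E.
Proof.
have [I0 SI0] := qsphere_nonempty R.
rewrite /sup_norm -ereal_supZl//; last first.
  by apply/set0P; exists (slice_norm r v I0), I0.
rewrite image_comp; congr ereal_sup; apply: eq_imagel => I SI /=.
exact: slice_normZ.
Qed.

Lemma sup_normD v w : (sup_norm (v + w)%R <= sup_norm v + sup_norm w)%E.
Proof.
apply: sup_norm_le => I SI; apply: (le_trans (slice_normD v w SI)).
by rewrite leeD// slice_norm_le_sup_norm.
Qed.

Lemma sup_norm_lty v :
  (sup_norm v < +oo)%E <-> [bounded (v : quat R -> quat R) q | q in qball r].
Proof.
have B0 : qball r 0 by rewrite /qball /= normr0.
(* The centre makes the filter of the ball proper, as [ex_bound] requires. *)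
have PF := globally_properfilter B0.
split=> [vy|/ex_bound[M vM]].
  apply/ex_bound; exists (fine (sup_norm v + sup_norm v)%E) => q qB /=.
  rewrite -lee_fin fineK; first exact: norm_le_sup_norm.
  by rewrite ge0_fin_numE ?adde_ge0 ?sup_norm_ge0// lte_add_pinfty.
apply: le_lt_trans (ltry (M + M)).
by apply: sup_norm_le => I SI; apply: slice_norm_le.
Qed.

End slice_norm.

Theorem proposition4p2 (R : realType) (r : R) (r_gt0 : 0 < r) :
  extended_norm (@sup_norm R r) /\
  forall f : slice_fun r,
    (sup_norm f < +oo)%E <-> [bounded f q | q in qball r].
Proof.
split; last by move=> f; exact: sup_norm_lty.
split; [exact: sup_norm_ge0|exact: sup_norm_eq0|exact: sup_normZ|].
exact: sup_normD.
Qed.
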